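(* Let $G$ be a circulant graph such that ${\rm Ind}(G)$ is vertex decomposable, respectively shellable. Then for every $m\geq 1$, the lexicographical product $G[K_m]$ is a circulant graph whose independence complex ${\rm Ind}(G[K_m])$ is also vertex decomposable, respectively shellable.
   Context: For $n\ge 1$ and $S\subseteq\{1,2,\ldots,\lfloor n/2\rfloor\}$, the circulant graph $C_n(S)$ has vertex set $\{x_0,\ldots,x_{n-1}\}$, with $\{x_a,x_b\}$ an edge iff $|a-b|\in S$ or $n-|a-b|\in S$; a circulant graph is a graph of this form. For graphs $G=(V_G,E_G)$, $H=(V_H,E_H)$, the lexicographical product $G[H]$ has vertex set $V_G\times V_H$, with $(w,x)$ and $(y,z)$ adjacent if $\{w,y\}\in E_G$, or if $w=y$ and $\{x,z\}\in E_H$. $K_m$ is the complete graph on $m$ vertices. ${\rm Ind}(G)$ is the simplicial complex of independent sets of $G$. A pure simplicial complex $\Delta$ is shellable if its facets (maximal faces) can be ordered $F_1,\ldots,F_s$ so that for all $1\le j<i\le s$ there exist $x\in F_i\setminus F_j$ and $k<i$ with $\{x\}=F_i\setminus F_k$. A pure simplicial complex $\Delta$ is vertex decomposable if it has a unique facet, or there is a vertex $x$ such that ${\rm del}_\Delta(x)=\{F\in\Delta: x\notin F\}$ and ${\rm link}_\Delta(x)=\{F\in\Delta: x\notin F,\ F\cup\{x\}\in\Delta\}$ are vertex decomposable. *)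

(* Defs.v *)
From mathcomp Require Import all_boot all_order all_algebra.

Set Implicit Arguments.
Unset Strict Implicit.
Unset Printing Implicit Defensive.

Record sgraph := SGraph {
  vertex :> finType;
  edge : rel vertex;
  edge_sym : symmetric edge;
  edge_irr : irreflexive edge }.

Definition graph_iso (G H : sgraph) : Prop :=
  exists f : G -> H, bijective f /\ forall x y, edge (f x) (f y) = edge x y.

Section Circulant.
Import IntDist.
Variables (n : nat) (S : {pred nat}).
Hypothesis n_gt0 : 1 <= n.
Hypothesis S_sub : {subset S <= [pred s | 1 <= s <= n %/ 2]}.

(* For a, b < n the subtraction n - |a - b| is never truncated. *)
Definition circulant_edge (a b : 'I_n) : bool :=
  (`|a - b|%N \in S) || (n - `|a - b|%N \in S).

Lemma circulant_edge_sym : symmetric circulant_edge.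
Proof. by move=> a b; rewrite /circulant_edge distnC. Qed.

Lemma circulant_edge_irr : irreflexive circulant_edge.
Proof.
move=> a; rewrite /circulant_edge distnn subn0; apply/negP=> /orP[] /S_sub //.
by rewrite inE n_gt0 /= leqNgt ltn_Pdiv.
Qed.

Definition circulant_graph : sgraph :=
  SGraph circulant_edge_sym circulant_edge_irr.
End Circulant.

(* Being circulant is understood up to isomorphism: the vertices of G[K_m] are
   pairs, so it can only be some C_n(S) after relabelling. *)
Definition circulant (G : sgraph) : Prop :=
  exists (n : nat) (S : {pred nat}) (n_gt0 : 1 <= n)
         (S_sub : {subset S <= [pred s | 1 <= s <= n %/ 2]}),
    graph_iso G (circulant_graph n_gt0 S_sub).

Section LexProduct.
Variables G H : sgraph.

Definition lex_edge (p q : G * H) : bool :=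
  edge p.1 q.1 || (p.1 == q.1) && edge p.2 q.2.

Lemma lex_edge_sym : symmetric lex_edge.
Proof.
by move=> p q; rewrite /lex_edge edge_sym eq_sym [edge p.2 _]edge_sym.
Qed.

Lemma lex_edge_irr : irreflexive lex_edge.
Proof. by move=> p; rewrite /lex_edge !edge_irr andbF. Qed.

Definition lex_product : sgraph := SGraph lex_edge_sym lex_edge_irr.
End LexProduct.

Section Complete.
Variable m : nat.

Definition complete_edge (i j : 'I_m) : bool := i != j.

Lemma complete_edge_sym : symmetric complete_edge.
Proof. by move=> i j; rewrite /complete_edge eq_sym. Qed.

Lemma complete_edge_irr : irreflexive complete_edge.
Proof. by move=> i; rewrite /complete_edge eqxx. Qed.

Definition complete_graph : sgraph :=
  SGraph complete_edge_sym complete_edge_irr.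
End Complete.

Section Complexes.
Variable T : finType.
Implicit Type D : {set {set T}}.

(* A complex is the set of its faces, the empty face included; its vertices are
   the x with [set x] \in D, which need not be all of T. *)
Definition simplicial_complex D : Prop :=
  set0 \in D /\ forall E F : {set T}, F \in D -> E \subset F -> E \in D.

Definition facets D : {set {set T}} :=
  [set F : {set T} | maxset (fun A : {set T} => A \in D) F].

Definition pure D : Prop :=
  {in facets D &, forall E F : {set T}, #|E| = #|F|}.

Definition pure_complex D : Prop := simplicial_complex D /\ pure D.

Definition del D (x : T) : {set {set T}} := [set F in D | x \notin F].

Definition link D (x : T) : {set {set T}} :=
  [set F in D | (x \notin F) && (x |: F \in D)].

Inductive vertex_decomposable : {set {set T}} -> Prop :=
| vd_simplex D :
    pure_complex D -> #|facets D| = 1 -> vertex_decomposable D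
| vd_shed D (x : T) :
    pure_complex D -> [set x] \in D ->
    vertex_decomposable (del D x) -> vertex_decomposable (link D x) ->
    vertex_decomposable D.

Definition shelling (s : seq {set T}) : Prop :=
  forall i j : nat, j < i -> i < size s ->
    exists (x : T) (k : nat),
      [/\ x \in nth set0 s i :\: nth set0 s j, k < i
        & [set x] = nth set0 s i :\: nth set0 s k].

Definition shellable D : Prop :=
  pure_complex D /\
  exists s : seq {set T}, [/\ uniq s, s =i facets D & shelling s].
End Complexes.

Definition independence_complex (G : sgraph) : {set {set G}} :=
  [set A : {set G} | [forall x in A, forall y in A, ~~ edge x y]].

(* Main.v *)
Require Import Defs.
From mathcomp Require Import all_boot all_order all_algebra.
From mathcomp Require Import zify.

(** The faces of Ind(G[K_m]) are the sets on which the projection to G is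
    injective and whose image is a face of Ind(G).  More generally, for a map
    [p : U -> T], a complex [D] on [T] and a set [W] of allowed labels meeting
    every fibre over a vertex of [D], consider the complex of the [A \subset W]
    that [p] maps injectively onto a face of [D].  If [x] is a shedding vertex
    of [D] and [w] lies over [x], then the link of [w] is the expansion of the
    link of [x], while the deletion of [w] is the expansion of [D] by [W :\ w]
    or, when [w] is the only label over [x], the expansion of the deletion of
    [x]; so vertex decomposability follows by induction on [D] and on [#|W|].
    A shelling of [D] lifts by ordering facets first by the position of their
    image, then by the sum of the ranks of their labels.  Finally,
    (a, i) |-> a + n i identifies C_n(S)[K_m] with a circulant graph on n m
    vertices. *)

Set Implicit Arguments.
Unset Strict Implicit.
Unset Printing Implicit Defensive.

(** * Facets, simplices, and shellings obtained by sorting *)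

Section Complexes.
Variable T : finType.
Implicit Types (D : {set {set T}}) (A B F : {set T}).

Lemma facet_face D F : F \in facets D -> F \in D.
Proof. by rewrite inE => /maxsetp. Qed.

Lemma facet_exists D A : A \in D -> exists2 F, F \in facets D & A \subset F.
Proof.
by move=> AD; have [F mF sAF] := @maxset_exists _ (fun B => B \in D) A AD;
  exists F; rewrite // inE.
Qed.

Lemma facet_max D F A : F \in facets D -> A \in D -> F \subset A -> A = F.
Proof. by rewrite inE => /maxsetP[_ mF] AD /mF; apply. Qed.

Lemma powerset_complex F : simplicial_complex (powerset F).
Proof.
split=> [|A B]; first by rewrite inE sub0set.
by rewrite !inE => sBF sAB; apply: subset_trans sBF.
Qed.

Lemma facets_powerset F : facets (powerset F) = [set F].
Proof.
apply/setP=> A; rewrite !inE; apply/maxsetP/eqP => [[]|->].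
  by rewrite inE => sAF /(_ F) <- //; rewrite inE.
by split=> [|B]; rewrite inE // => sBF sFB; apply/eqP; rewrite eqEsubset sBF.
Qed.

Lemma powerset_pure F : pure (powerset F).
Proof. by move=> A B; rewrite facets_powerset !inE => /eqP-> /eqP->. Qed.

Lemma one_facet_powerset D :
  simplicial_complex D -> #|facets D| = 1 -> exists F, D = powerset F.
Proof.
move=> [_ sD] /eqP/cards1P[F fF]; exists F; apply/setP=> A; rewrite inE.
apply/idP/idP=> [/facet_exists[B]|sAF]; first by rewrite fF inE => /eqP->.
by apply: sD sAF; apply: facet_face; rewrite fF inE.
Qed.

Lemma del_powerset F x : del (powerset F) x = powerset (F :\ x).
Proof. by apply/setP=> A; rewrite !inE subsetD1. Qed.

Lemma link_powerset F x : x \in F -> link (powerset F) x = powerset (F :\ x).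
Proof.
move=> xF; apply/setP=> A; rewrite !inE subsetD1 subUset sub1set xF /=.
by case: (A \subset F); rewrite ?andbT ?andbF.
Qed.

Lemma vertex_decomposable_pure D : vertex_decomposable D -> pure_complex D.
Proof. by case. Qed.

(* A simplex can itself be shed down to the complex [[set set0]]. *)
Lemma vertex_decomposable_shed_ind (P : {set {set T}} -> Prop) :
  P (powerset set0) ->
  (forall D x, pure_complex D -> [set x] \in D ->
    pure_complex (del D x) -> pure_complex (link D x) ->
    P (del D x) -> P (link D x) -> P D) ->
  forall D, vertex_decomposable D -> P D.
Proof.
move=> P0 Pshed D; elim=> {D}[D [sD _] /(one_facet_powerset sD)[F ->]|].
  have [n] := ubnP #|F|; elim: n F => // n IHn F leFn.
  have [->//|[x xF]] := set_0Vmem F.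
  have PF1 : P (powerset (F :\ x)).
    by apply: IHn; rewrite (cardsD1 x) xF in leFn.
  have purP B : pure_complex (powerset B).
    by split; [apply: powerset_complex | apply: powerset_pure].
  apply: (Pshed _ x); rewrite ?del_powerset ?link_powerset //.
  by rewrite inE sub1set.
move=> D x pD Dx vdel Pdel vlink Plink.
by apply: (Pshed _ x) => //; apply: vertex_decomposable_pure.
Qed.

(** The shelling is the list of facets sorted by [key]. Facets of equal key come in an unspecified
    order, so the exchange is required whenever [key B <= key A]; the strict [key C < key A] then
    forces [C] to precede [A]. *)
Lemma shellable_key D (key : {set T} -> nat) :
  pure_complex D ->
  (forall A B, A \in facets D -> B \in facets D -> A != B -> key B <= key A ->
     exists x C, [/\ x \in A :\: B, C \in facets D, key C < key A
                   & [set x] = A :\: C]) ->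
  shellable D.
Proof.
move=> pD keyP; split=> //.
pose r := relpre key leq; pose s := sort r (enum (facets D)).
have r_tot : total r by move=> A B; apply: leq_total.
have r_trans : transitive r by move=> A B C; apply: leq_trans.
have us : uniq s by rewrite sort_uniq enum_uniq.
have ms : s =i facets D by move=> A; rewrite mem_sort mem_enum.
have key_nth i j : i <= j -> j < size s ->
    key (nth set0 s i) <= key (nth set0 s j).
  move=> leij ltjs; apply: (sorted_leq_nth r_trans _ _ (sort_sorted r_tot _));
    rewrite ?inE //; first by move=> A; apply: leqnn.
  exact: leq_ltn_trans ltjs.
exists s; split=> // i j ltji ltis; have ltjs := ltn_trans ltji ltis.
have [] := keyP (nth set0 s i) (nth set0 s j).
- by rewrite -ms mem_nth.
- by rewrite -ms mem_nth.
- by rewrite nth_uniq // gtn_eqF.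
- exact: key_nth (ltnW ltji) ltis.
move=> x [C [xAB CF ltC eqx]]; have Cs : C \in s by rewrite ms.
exists x, (index C s); rewrite nth_index //; split=> //.
rewrite ltnNge; apply: contraL ltC => lei; rewrite -leqNgt.
by rewrite -[C in _ <= key C](nth_index set0 Cs) key_nth // index_mem.
Qed.

End Complexes.

(** * Expansion of a complex along a map *)

Section Expansion.
Variables (U T : finType) (p : U -> T).
Implicit Types (D : {set {set T}}) (W A B C : {set U}) (F : {set T}).

(** Comparing cardinals is a boolean way to say that [p] is injective on [A]. *)
Definition expansion D W : {set {set U}} :=
  [set A : {set U} | [&& A \subset W, p @: A \in D & #|p @: A| == #|A|]].

Definition fibres_met D W : Prop :=
  forall x, [set x] \in D -> exists2 w, w \in W & p w = x.

Lemma expansionP D W A :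
  reflect [/\ A \subset W, p @: A \in D & {in A &, injective p}]
          (A \in expansion D W).
Proof. by rewrite inE; apply: (iffP and3P) => -[? ? /imset_injP]. Qed.

Lemma card_expansion D W A : A \in expansion D W -> #|p @: A| = #|A|.
Proof. by rewrite inE => /and3P[_ _ /eqP]. Qed.

Lemma expansion_complex D W :
  simplicial_complex D -> simplicial_complex (expansion D W).
Proof.
move=> [D0 sD]; split=> [|A B]; first by rewrite inE sub0set imset0 D0 !cards0.
case/expansionP=> sBW DB injB sAB; apply/expansionP; split.
- exact: subset_trans sBW.
- by apply: sD DB _; apply: imsetS.
- by move=> u v Au Av; apply: injB; apply: (subsetP sAB).
Qed.

Lemma expansion_add D W A w :
  A \in expansion D W -> w \in W -> p w \notin p @: A -> p w |: p @: A \in D ->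
  w |: A \in expansion D W.
Proof.
move=> EA Ww npw Dw; have cA := card_expansion EA.
case/expansionP: EA => sAW _ _; rewrite inE subUset sub1set Ww sAW imsetU1 Dw.
rewrite !cardsU1 npw cA; suff -> : w \notin A by rewrite eqxx.
by apply: contra npw; apply: imset_f.
Qed.

(** Take [B] maximal among the faces that contain [A] and map into [F]: a vertex of [F] outside the
    image of [B] has a label in [W], which could be added to [B]. *)
Lemma expansion_extend D W A F :
  simplicial_complex D -> fibres_met D W ->
  A \in expansion D W -> p @: A \subset F -> F \in D ->
  exists B, [/\ A \subset B, B \in expansion D W & p @: B = F].
Proof.
move=> [_ sD] mW EA sAF DF.
have [|B /maxsetP[/andP[EB sBF] maxB] sAB] := @maxset_exists _
  (fun B => (B \in expansion D W) && (p @: B \subset F)) A.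
  by rewrite EA.
exists B; split=> //; apply/eqP; rewrite eqEsubset sBF /=; apply/subsetP=> x Fx.
have [|w Ww px] := mW x; first by apply: sD DF _; rewrite sub1set.
subst x; apply: contraT => npw.
have sF : p w |: p @: B \subset F by rewrite subUset sub1set Fx.
have EwB : w |: B \in expansion D W by apply: expansion_add => //; apply: sD sF.
have := maxB (w |: B); rewrite EwB imsetU1 sF subsetUr => /(_ isT isT) eqB.
by case/negP: npw; apply: imset_f; rewrite -eqB setU11.
Qed.

(** A facet extends to a face over any facet containing its image, so its image is that facet.
    Conversely, if [p @: A] is a facet, a face containing [A] has the same image, hence the same
    cardinality. *)
Lemma facets_expansion D W A :
  simplicial_complex D -> fibres_met D W ->
  (A \in facets (expansion D W)) =
    (A \in expansion D W) && (p @: A \in facets D).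
Proof.
move=> cD mW; apply/idP/andP=> [fA | [EA fpA]].
  have EA := facet_face fA; split=> //.
  have [_ DpA _] := expansionP _ _ _ EA.
  have [F fF sAF] := facet_exists DpA.
  have [B [sAB EB pB]] := expansion_extend cD mW EA sAF (facet_face fF).
  by rewrite -(facet_max fA EB sAB) pB.
rewrite inE; apply/maxsetP; split=> // B EB sAB.
have [_ DpB _] := expansionP _ _ _ EB.
have eqp := facet_max fpA DpB (imsetS p sAB).
apply/esym/eqP; rewrite eqEcard sAB -(card_expansion EA) -(card_expansion EB).
by rewrite eqp /=.
Qed.

Lemma expansion_pure D W :
  pure_complex D -> fibres_met D W -> pure_complex (expansion D W).
Proof.
move=> [cD pD] mW; split=> [|A B]; first exact: expansion_complex.
rewrite !facets_expansion // => /andP[EA fA] /andP[EB fB].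
by rewrite -(card_expansion EA) -(card_expansion EB); apply: pD.
Qed.

Lemma del_expansion D W w : del (expansion D W) w = expansion D (W :\ w).
Proof.
by apply/setP=> A; rewrite !inE subsetD1 -andbA [RHS]andbAC -!andbA;
  do !bool_congr.
Qed.

Lemma expansion_del D W w :
  w \in W -> {in W, forall v, p v = p w -> v = w} ->
  expansion D (W :\ w) = expansion (del D (p w)) W.
Proof.
move=> Ww uw; apply/setP=> A; rewrite !inE subsetD1.
have [sAW|//] := boolP (A \subset W); rewrite /= -andbA andbCA; congr (_ && _).
congr (~~ _ && _); apply/idP/imsetP=> [Aw|[v Av /esym eqp]]; first by exists w.
by rewrite -(uw v) // (subsetP sAW).
Qed.

(** [W] need not shrink: faces of [link D (p w)] avoid [p w], so no label over [p w] can occur above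
    them. *)
Lemma link_expansion D W w :
  simplicial_complex D -> w \in W ->
  link (expansion D W) w = expansion (link D (p w)) W.
Proof.
move=> [_ sD] Ww; apply/setP=> A; rewrite inE.
apply/and3P/expansionP=> [[EA nAw /expansionP[_ DwA injwA]]|].
  have [sAW DA injA] := expansionP _ _ _ EA; split=> //.
  rewrite inE DA -imsetU1 DwA andbT; apply/imsetP=> -[v Av eqp].
  by case/negP: nAw; rewrite (injwA w v) ?setU11 // !inE Av orbT.
case=> sAW; rewrite inE => /and3P[DA npw DwA] injA.
have EA : A \in expansion D W by apply/expansionP.
split=> //; first by apply: contra npw; apply: imset_f.
exact: expansion_add.
Qed.

Lemma fibres_metS D D' W :
  D' \subset D -> fibres_met D W -> fibres_met D' W.
Proof. by move=> /subsetP sD mW x /sD/mW. Qed.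

Lemma expansion_vertex_decomposable D W :
  vertex_decomposable D -> fibres_met D W ->
  vertex_decomposable (expansion D W).
Proof.
move=> vD; move: D vD W; apply: vertex_decomposable_shed_ind => [W mW|].
  have eqE : expansion (powerset set0) W = powerset set0.
    apply/setP=> A; rewrite !inE !subset0 imset_eq0.
    by have [->|_] := eqVneq A set0; rewrite ?andbF // sub0set imset0 !cards0.
  rewrite eqE; apply: vd_simplex; last by rewrite facets_powerset cards1.
  by split; [apply: powerset_complex | apply: powerset_pure].
move=> D x pD Dx pdel plink IHdel IHlink W.
have [n] := ubnP #|W|; elim: n W => // n IHn W leWn mW.
have [w Ww px] := mW x Dx; subst x.
have sdel : del D (p w) \subset D by apply/subsetP=> A; rewrite inE => /andP[].
have slink : link D (p w) \subset D.
  by apply/subsetP=> A; rewrite inE => /andP[].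
apply: (@vd_shed _ _ w); first exact: expansion_pure.
- by rewrite inE sub1set Ww imset_set1 Dx !cards1.
- rewrite del_expansion.
  have [/exists_inP[v Wv /andP[nvw /eqP pv]]|uw] :=
      boolP [exists v in W, (v != w) && (p v == p w)].
    apply: IHn => [|y Dy]; first by rewrite (cardsD1 w) Ww in leWn.
    (* Over [p w] the second label [v] takes the place of [w], so [W :\ w] still meets the
       fibres. *)
    have [u Wu pu] := mW y Dy; have [eqw|nuw] := eqVneq u w.
      by exists v; rewrite ?inE ?nvw // pv -eqw.
    by exists u; rewrite ?inE ?nuw.
  rewrite expansion_del // => [|v Wv pv]; first exact: IHdel (fibres_metS _ mW).
  apply: contraNeq uw => nvw; apply/exists_inP; exists v => //.
  by rewrite nvw pv eqxx.
- rewrite link_expansion //; last by case: pD.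
  exact: IHlink (fibres_metS _ mW).
Qed.

(** Tie-breaker between facets with the same image. *)
Let weight A := \sum_(w in A) enum_rank w.

(* If every label of [A] were at most the label of [B] in the same fibre, the
   weights would force equality throughout. *)
Lemma exists_smaller_label A B :
  {in A &, injective p} -> {in B &, injective p} -> p @: A = p @: B ->
  A != B -> weight B <= weight A ->
  exists a b, [/\ a \in A, b \in B, p a = p b & enum_rank b < enum_rank a].
Proof.
move=> injA injB eqp neqAB leBA.
have [/exists_inP[a Aa /exists_inP[b Bb /andP[/eqP pab ltba]]]|none] :=
    boolP [exists a in A, exists b in B, (p a == p b) &&
             (enum_rank b < enum_rank a)].
  by exists a, b.
have le_ab a b : a \in A -> b \in B -> p a = p b -> enum_rank a <= enum_rank b.
  move=> Aa Bb pab; rewrite leqNgt; apply: contra none => ltba.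
  by apply/exists_inP; exists a => //; apply/exists_inP; exists b;
    rewrite // pab eqxx.
(* [f a] is the label of [B] in the fibre of [a]; the default is never reached on [A], since the
   images agree. *)
pose f a := odflt a [pick b in B | p b == p a].
have fP a : a \in A -> f a \in B /\ p (f a) = p a.
  move=> Aa; rewrite /f; case: pickP => [b /andP[Bb /eqP]//|nob].
  have /imsetP[b Bb pab] : p a \in p @: B by rewrite -eqp imset_f.
  by have := nob b; rewrite Bb pab eqxx.
have injf : {in A &, injective f}.
  move=> a a' Aa Aa' eqf; apply: injA => //.
  by rewrite -(proj2 (fP _ Aa)) eqf (proj2 (fP _ Aa')).
have fAB : f @: A = B.
  apply/eqP; rewrite eqEcard card_in_imset // -(card_in_imset injA) eqp.
  rewrite (card_in_imset injB) leqnn andbT.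
  by apply/subsetP=> _ /imsetP[a Aa ->]; case: (fP _ Aa).
have le_f a : a \in A -> enum_rank a <= enum_rank (f a) ?= iff (a == f a).
  move=> Aa; have [Bf pf] := fP a Aa; split; first exact: le_ab.
  by rewrite (inj_eq val_inj) (inj_eq enum_rank_inj).
have eqwB : weight B = \sum_(a in A) enum_rank (f a).
  by rewrite /weight -fAB big_imset.
have := leqif_sum le_f; rewrite -eqwB.
case=> leAB eqAB; have : weight A == weight B by rewrite eqn_leq leAB.
rewrite eqAB => /forall_inP fid; case/eqP: neqAB; rewrite -fAB -[LHS]imset_id.
by apply: eq_in_imset => a /fid/eqP.
Qed.

Lemma weight_swap A a b :
  a \in A -> enum_rank b < enum_rank a -> weight (b |: A :\ a) < weight A.
Proof.
move=> Aa ltba; rewrite /weight [ltnRHS](big_setD1 a) //=.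
have [Ab|nAb] := boolP (b \in A :\ a); last first.
  by rewrite big_setU1 //= ltn_add2r.
(* If [b] is already in [A], the swap only drops the rank of [a], which is positive because it
   exceeds that of [b]. *)
rewrite (setUidPr _) ?sub1set // -[ltnLHS]add0n ltn_add2r.
exact: leq_ltn_trans ltba.
Qed.

Lemma expansion_shellable D W :
  shellable D -> fibres_met D W -> shellable (expansion D W).
Proof.
move=> [pD [s [us ms shs]]] mW; have [cD _] := pD; have [_ sD] := cD.
(* [N] exceeds every weight, so [key] compares lexicographically: position of the image first,
   weight second. *)
pose N := (weight setT).+1.
have ltN A : weight A < N.
  by rewrite ltnS /weight [leqRHS](big_setID A) /= setTI leq_addr.
pose key A := index (p @: A) s * N + weight A.
apply: (shellable_key (key := key)) => [|A B]; first exact: expansion_pure.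
rewrite !facets_expansion // => /andP[EA fA] /andP[EB fB] neqAB leBA.
have [sAW DA injA] := expansionP _ _ _ EA.
have [sBW DB injB] := expansionP _ _ _ EB.
have key_lt C : index (p @: C) s < index (p @: A) s -> key C < key A.
  by move=> lti; rewrite /key; have := ltN C; nia.
(* With equal images, exchanging one label of [A] for the smaller label of [B] in its fibre keeps
   the image and lowers the weight. *)
have [eqp|neqp] := eqVneq (p @: A) (p @: B).
  have leW : weight B <= weight A by move: leBA; rewrite /key eqp leq_add2l.
  have [a [b [Aa Bb pab ltba]]] := exists_smaller_label injA injB eqp neqAB leW.
  have nab : b != a by apply: contraTneq ltba => ->; rewrite ltnn.
  have nBa : a \notin B.
    by apply: contra nab => Ba; apply/eqP/injB.
  have nAb : b \notin A.
    by apply: contra nab => Ab; apply/eqP/injA.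
  have pC : p @: (b |: A :\ a) = p @: A.
    by rewrite imsetU1 -pab -imsetU1 setD1K.
  have EC : b |: A :\ a \in expansion D W.
    rewrite inE pC DA (card_expansion EA) subUset sub1set (subsetP sBW) //.
    rewrite (subset_trans (subsetDl _ _) sAW) cardsU1 !inE (negbTE nAb) andbF.
    by rewrite (cardsD1 a A) Aa eqxx.
  exists a, (b |: A :\ a); split; first by rewrite inE nBa.
  - by rewrite facets_expansion // EC pC.
  - by rewrite /key pC ltn_add2l weight_swap.
  - apply/setP=> c; rewrite !inE; have [->|nca] := eqVneq c a.
      by rewrite Aa eq_sym (negbTE nab).
    by case: (c \in A); rewrite ?orbT ?andbF.
(* With distinct images, that of [B] comes strictly earlier in [s], and the shelling of [D] supplies
   an earlier facet [F] missing exactly one vertex [p w] of [p @: A]. *)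
have lti : index (p @: B) s < index (p @: A) s.
  rewrite ltn_neqAle; apply/andP; split.
    apply: contra neqp => /eqP eqi.
    by rewrite -(nth_index set0 (_ : p @: A \in s)) -?eqi ?nth_index ?ms.
  rewrite leqNgt; apply/negP=> lti; move: leBA; rewrite leqNgt /key.
  by have := ltN A; nia.
have [|x [k [xAB ltk eqx]]] := shs _ _ lti; first by rewrite index_mem ms.
rewrite !nth_index ?ms // in xAB eqx.
have lts : k < size s by apply: ltn_trans ltk _; rewrite index_mem ms.
set F := nth set0 s k in eqx.
have fF : F \in facets D by rewrite -ms mem_nth.
case/setDP: xAB => /imsetP[w Aw px] nBx; subst x.
have nFw : p w \notin F by have := set11 (p w); rewrite eqx inE => /andP[].
have EA1 : A :\ w \in expansion D W.
  by have [_ cl] := expansion_complex W cD; apply: cl EA _; apply: subsetDl.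
have sF : p @: (A :\ w) \subset F.
  apply/subsetP=> _ /imsetP[v /setD1P[nvw Av] ->]; apply: contraR nvw => nF.
  have : p v \in [set p w] by rewrite eqx inE nF imset_f.
  by rewrite inE => /eqP/injA->.
(* [C] contains [A :\ w] and lies over [F], which omits [p w]; hence [A :\: C] is exactly [w]. *)
have [C [sC EC pC]] := expansion_extend cD mW EA1 sF (facet_face fF).
exists w, C; split.
- by rewrite inE Aw andbT; apply: contra nBx; apply: imset_f.
- by rewrite facets_expansion // EC pC.
- by apply: key_lt; rewrite pC index_uniq.
- apply/setP=> v; rewrite !inE; have [->|nvw] := eqVneq v w.
    by rewrite Aw andbT; apply/esym; apply: contra nFw => /(imset_f p); rewrite pC.
  have [Av|] := boolP (v \in A); last by rewrite andbF.
  by rewrite (subsetP sC) // !inE nvw.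
Qed.

End Expansion.

(** * The independence complex of G[K_m] as an expansion *)

Section LexComplete.
Variables (G : sgraph) (m : nat).
Hypothesis m_gt0 : 1 <= m.
Let GK := lex_product G (complete_graph m).

(** Distinct vertices over the same vertex of [G] are always adjacent, so an independent set has at
    most one in each fibre; between different fibres adjacency is that of [G]. *)
Lemma independence_complex_lex :
  independence_complex GK =
    expansion (fst : GK -> G) (independence_complex G) setT.
Proof.
apply/setP=> A; apply/idP/expansionP.
  rewrite inE => /forall_inP indA.
  have {}indA u v : u \in A -> v \in A -> ~~ @edge GK u v.
    by move=> Au; move/forall_inP: (indA u Au); apply.
  split; first exact: subsetT.
    rewrite inE; apply/forall_inP=> _ /imsetP[u Au ->].
    apply/forall_inP=> _ /imsetP[v Av ->].
    by have := indA u v Au Av; rewrite /= /lex_edge negb_or => /andP[].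
  move=> [x i] [y j] Au Av /= eqxy; have := indA _ _ Au Av; subst y.
  by rewrite /= /lex_edge /= edge_irr eqxx /= /complete_edge negbK => /eqP->.
case=> _; rewrite inE => /forall_inP indA injA; rewrite inE.
apply/forall_inP=> u Au; apply/forall_inP=> v Av.
have /forall_inP/(_ v.1 (imset_f _ Av)) := indA u.1 (imset_f _ Au).
rewrite /= /lex_edge negb_or => -> /=.
by have [/injA eqv|//] := eqVneq u.1 v.1; rewrite eqv // /complete_edge eqxx.
Qed.

Lemma fibres_met_lex D : fibres_met (fst : GK -> G) D setT.
Proof. by move=> x _; exists (x, Ordinal m_gt0). Qed.

End LexComplete.

Import IntDist.

(** * Circulant structure on G[K_m] *)

Section CirculantBlowup.
Variables (n m : nat) (S : {pred nat}).
Hypothesis S_sub : {subset S <= [pred s | 1 <= s <= n %/ 2]}.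

(** Only the residue modulo [n] matters; residue 0 accounts for the edges between copies of one
    vertex. *)
Let Q d := [|| d %% n \in S, n - d %% n \in S | d %% n == 0].

Definition blowup_distances : {pred nat} :=
  [pred s | (1 <= s <= (n * m) %/ 2) && Q s].

Lemma blowup_distances_sub :
  {subset blowup_distances <= [pred s | 1 <= s <= (n * m) %/ 2]}.
Proof. by move=> s /andP[]. Qed.

(** Passing from [d] to [n * m - d] fixes a zero residue and turns a nonzero residue r into n - r,
    which swaps the two tests against [S]. *)
Let Q_opp d : 0 < n -> d <= n * m -> Q (n * m - d) = Q d.
Proof.
move=> n_gt0 led; rewrite /Q.
have [r0|r_neq0] := eqVneq (d %% n) 0.
  have -> : (n * m - d) %% n = 0.
    by apply/eqP; rewrite -/(dvdn _ _) dvdn_subr ?dvdn_mulr //; apply/eqP.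
  by rewrite !orbT.
have ltr := ltn_pmod d n_gt0.
have -> : (n * m - d) %% n = n - d %% n.
  have def_d := divn_eq d n; have ltq : d %/ n < m by nia.
  have -> : n * m - d = (m - (d %/ n).+1) * n + (n - d %% n).
    by rewrite {1}def_d -{1}(subnK ltq); nia.
  by rewrite modnMDl modn_small //; lia.
rewrite subKn ?(ltnW ltr) // subn_eq0 leqNgt ltr !orbF.
exact: orbC.
Qed.

(** For nonzero [d], [Q_opp] reduces the left side to [Q d], and the residue of [d] modulo [n] is
    read off from [a] and [b]. *)
Lemma blowup_edge (a b i j : nat) :
  a < n -> b < n -> i < m -> j < m ->
  let d := `|a + n * i - (b + n * j)|%N in
  (d \in blowup_distances) || (n * m - d \in blowup_distances) =
  (`|a - b|%N \in S) || (n - `|a - b|%N \in S) || (a == b) && (i != j).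
Proof.
wlog leu : a b i j / b + n * j <= a + n * i => [IH|] lta ltb lti ltj.
  have [leu|/ltnW leu] := leqP (b + n * j) (a + n * i); first exact: IH.
  rewrite distnC [X in X \in S]distnC [X in n - X]distnC.
  by rewrite [a == b]eq_sym [i == j]eq_sym; apply: IH.
have n_gt0 : 0 < n by apply: leq_ltn_trans lta.
have nS0 : (0 \in S) = false by apply/negP => /S_sub.
have nSn : (n \in S) = false.
  by apply/negP => /S_sub; rewrite inE n_gt0 leqNgt ltn_Pdiv.
rewrite /= distnEl //; set d := _ - _.
have ltd : d < n * m by rewrite /d; nia.
(* For [d = 0] the vertices coincide and both sides are false: neither 0 nor [n * m] is an allowed
   distance, and [S] contains neither 0 nor [n]. *)
have [d0|d_gt0] := posnP d.
  have eqij : i = j by move: d0; rewrite /d; case: (ltngtP i j) => // _; nia.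
  have eqab : a = b by move: d0; rewrite /d eqij; lia.
  rewrite d0 eqab eqij distnn !eqxx !subn0 nS0 nSn !inE /=.
  by rewrite [_ <= _ %/ 2]leqNgt ltn_Pdiv ?andbF // (leq_ltn_trans _ ltd).
rewrite !inE Q_opp ?(ltnW ltd) // -andb_orl d_gt0 subn_gt0 ltd /=.
(* Two numbers with sum [n * m] cannot both exceed its half. *)
have -> : (d <= n * m %/ 2) || (n * m - d <= n * m %/ 2) by lia.
have [eqab|neqab] := eqVneq a b.
  have neqij : i != j.
    by apply: contraTneq d_gt0 => eqij; rewrite /d eqab eqij subnn.
  rewrite neqij orbT /Q; have -> : d = n * (i - j) by rewrite /d eqab; nia.
  by rewrite modnMr eqxx !orbT.
have [ltba|leab] := ltnP b a.
  have dm : d %% n = a - b.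
    have leji : j <= i by nia.
    have -> : d = (i - j) * n + (a - b).
      by rewrite /d -{1}(subnK leji); nia.
    by rewrite modnMDl modn_small //; lia.
  by rewrite /Q dm distnEl ?(ltnW ltba) // subn_eq0 leqNgt ltba !orbF.
have ltab : a < b by rewrite ltn_neqAle neqab.
(* Since [a < b], the subtraction borrows one block of length [n]; the two tests against [S] trade
   places. *)
have dm : d %% n = n - (b - a).
  have ltji : j < i by nia.
  have -> : d = (i - j.+1) * n + (n - (b - a)).
    by rewrite /d -{1}(subnK ltji); nia.
  by rewrite modnMDl modn_small //; lia.
rewrite /Q dm distnEr // subKn; last by lia.
have -> : (n - (b - a) == 0) = false by lia.
by rewrite !orbF orbC.
Qed.

End CirculantBlowup.

Lemma circulant_lex_complete (G : sgraph) (m : nat) :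
  1 <= m -> circulant G -> circulant (lex_product G (complete_graph m)).
Proof.
move=> m_gt0 [n [S [n_gt0 [S_sub [f [bijf edgef]]]]]].
have nm_gt0 : 1 <= n * m by rewrite muln_gt0 n_gt0.
exists (n * m), (blowup_distances n m S), nm_gt0, (@blowup_distances_sub n m S).
have lt_h (u : G * 'I_m) : f u.1 + n * u.2 < n * m.
  by have := ltn_ord (f u.1); have := ltn_ord u.2; nia.
pose h u : 'I_(n * m) := Ordinal (lt_h u).
exists h; split=> [|[x i] [y j]].
  (* Injectivity suffices by cardinality; reduction modulo [n] recovers [f x], and then [i]
     follows. *)
  apply: inj_card_bij => [[x i] [y j] /(congr1 val) /= eqh|]; last first.
    by rewrite card_prod !card_ord (bij_eq_card bijf) card_ord.
  have eqf : f x = f y.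
    apply: val_inj; rewrite /= -(modn_small (ltn_ord (f x))).
    rewrite -(modn_small (ltn_ord (f y))) -(modnMDl i) -[RHS](modnMDl j).
    by rewrite ![_ * n + _]addnC ![_ * n]mulnC eqh.
  rewrite (bij_inj bijf eqf); congr (_, _); apply: val_inj => /=.
  by move: eqh; rewrite eqf; nia.
rewrite /= /circulant_edge blowup_edge // /lex_edge /= -edgef.
by rewrite -(bij_eq bijf).
Qed.

Theorem theorem4p2 (G : sgraph) (G_circulant : circulant G) :
  (vertex_decomposable (independence_complex G) ->
   forall m : nat, 1 <= m ->
     circulant (lex_product G (complete_graph m)) /\
     vertex_decomposable
       (independence_complex (lex_product G (complete_graph m)))) /\
  (shellable (independence_complex G) ->
   forall m : nat, 1 <= m ->
     circulant (lex_product G (complete_graph m)) /\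
     shellable (independence_complex (lex_product G (complete_graph m)))).
Proof.
split=> [vG|sG] m m_gt0; split; try exact: circulant_lex_complete;
  rewrite independence_complex_lex.
- by apply: expansion_vertex_decomposable => //; apply: fibres_met_lex.
- by apply: expansion_shellable => //; apply: fibres_met_lex.
Qed.
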